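(* Let $m,n,k\ge1$ be integers, let $A\in\mathbb{R}^{m\times n}$ with $r=\operatorname{rank}(A)$, and let $E_2,\dots,E_k\in\mathbb{R}^{m\times n}$. Let \[ \widetilde M=[A,\,A+E_2,\,A+E_3,\dots,A+E_k]\in\mathbb{R}^{m\times kn}. \] Then for every $i=1,\dots,r$, \[ |\sigma_i(\widetilde M)-\sqrt{k}\,\sigma_i(A)|\le\frac{1}{\sqrt{k}\,\sigma_i(A)}\sum_{j=2}^k\bigl(2\|A\|_2\|E_j\|_2+\|E_j\|_2^2\bigr), \] and for every $i=r+1,\dots,\min(m,kn)$, \[ \sigma_i(\widetilde M)\le\sqrt{\sum_{j=2}^k\bigl(2\|A\|_2\|E_j\|_2+\|E_j\|_2^2\bigr)}. \]
   Context: $\|\cdot\|_2$ denotes the spectral (operator) norm of a matrix. For $X\in\mathbb{R}^{p\times q}$, $\sigma_1(X)\ge\dots\ge\sigma_{\min(p,q)}(X)\ge0$ are its singular values in non-increasing order, counted with multiplicity. Square brackets denote horizontal concatenation. *)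

(* Defs.v *)
From HB Require Import structures.
From mathcomp Require Import all_boot all_order all_algebra.
From mathcomp Require Import polyrcf.
From mathcomp Require Import classical_sets reals.

Set Implicit Arguments.
Unset Strict Implicit.
Unset Printing Implicit Defensive.

Import Order.TTheory GRing.Theory Num.Theory.

Local Open Scope ring_scope.
Local Open Scope classical_set_scope.

Section SingularValues.
Context {R : realType}.

Definition l2norm n (v : 'cV[R]_n) : R := Num.sqrt (\sum_i v i 0 ^+ 2).

(* The closed unit ball is used rather than the unit sphere so that the set is
   nonempty also when q = 0. *)
Definition spectral_norm p q (X : 'M[R]_(p, q)) : R :=
  sup [set l2norm (X *m v) | v in [set v : 'cV[R]_q | l2norm v <= 1]].

(* [rootsR] lists each real root once, so every root is repeated according to
   its multiplicity in the characteristic polynomial. *)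
Definition real_eigenvalues n (S : 'M[R]_n) : seq R :=
  flatten [seq nseq (mup x (char_poly S)) x | x <- rootsR (char_poly S)].

(* [X^T *m X] has q nonnegative eigenvalues with multiplicity; when p < q, at
   least q - p of them vanish, and only the minn p q largest are kept. *)
Definition singular_values p q (X : 'M[R]_(p, q)) : seq R :=
  take (minn p q)
    (sort >=%R [seq Num.sqrt x | x <- real_eigenvalues (X^T *m X)]).

(* The index i is 1-based and meaningful for 1 <= i <= minn p q only. *)
Definition singular_value i p q (X : 'M[R]_(p, q)) : R :=
  nth 0 (singular_values X) i.-1.

End SingularValues.

(* Main.v *)
(* For t >= 0, sigma_i(X) > t holds if and only if some i-dimensional space of
   row vectors v satisfies |v X| > t |v| away from 0 (a Courant-Fischer
   principle, stated on the left so that column blocks only add up). Since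
   |u M|^2 = \sum_j |u M_j|^2, the quadratic forms |u M|^2 and k |u A|^2 differ
   by at most s |u|^2; transporting witness subspaces between M and A gives
   |sigma_i(M)^2 - k sigma_i(A)^2| <= s, and both bounds follow. *)
Require Import Defs.
From mathcomp Require Import all_boot all_order all_algebra.
From mathcomp Require Import polyrcf complex.
From mathcomp Require Import classical_sets reals.
From mathcomp Require Import ring lra.

Import Order.TTheory GRing.Theory Num.Theory.

Local Open Scope ring_scope.

(** * The dot product on row vectors and the Cauchy-Schwarz inequality *)

Section DotProduct.
Context {R : rcfType}.

Definition dot n (u v : 'rV[R]_n) : R := (u *m v^T) 0 0.
Local Notation "''[' u , v ]" := (dot _ u v).
Local Notation "''[' u ]" := (dot _ u u).

Lemma dotE n (u v : 'rV[R]_n) : '[u, v] = \sum_i u 0 i * v 0 i.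
Proof. by rewrite /dot mxE; apply: eq_bigr => i _; rewrite mxE. Qed.

Lemma mulmx_trE n (u v : 'rV[R]_n) : u *m v^T = '[u, v]%:M.
Proof. exact: mx11_scalar. Qed.

Lemma dotC n (u v : 'rV[R]_n) : '[u, v] = '[v, u].
Proof. by rewrite !dotE; apply: eq_bigr => i _; rewrite mulrC. Qed.

Lemma dotDl n (u v w : 'rV[R]_n) : '[u + v, w] = '[u, w] + '[v, w].
Proof. by rewrite /dot mulmxDl mxE. Qed.

Lemma dotDr n (u v w : 'rV[R]_n) : '[u, v + w] = '[u, v] + '[u, w].
Proof. by rewrite dotC dotDl !(dotC _ u). Qed.

Lemma dotZl n a (u v : 'rV[R]_n) : '[a *: u, v] = a * '[u, v].
Proof. by rewrite /dot -scalemxAl mxE. Qed.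

Lemma dotZr n a (u v : 'rV[R]_n) : '[u, a *: v] = a * '[u, v].
Proof. by rewrite dotC dotZl dotC. Qed.

Lemma dot_mulmx p q (u : 'rV[R]_p) (X : 'M_(p, q)) v :
  '[u *m X, v] = '[u, v *m X^T].
Proof. by rewrite /dot trmx_mul trmxK mulmxA. Qed.

Lemma dot_ge0 n (u : 'rV[R]_n) : 0 <= '[u].
Proof. by rewrite dotE sumr_ge0 // => i _; rewrite -expr2 sqr_ge0. Qed.

Lemma dot_eq0 n (u : 'rV[R]_n) : ('[u] == 0) = (u == 0).
Proof.
rewrite dotE psumr_eq0; last by move=> i _; rewrite -expr2 sqr_ge0.
apply/allP/eqP => [u0|-> i _]; last by rewrite !mxE mulr0 eqxx.
apply/rowP => i; rewrite mxE; apply/eqP.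
by have := u0 i (mem_index_enum _); rewrite -expr2 sqrf_eq0.
Qed.

Lemma dot00 n : '[0 : 'rV[R]_n] = 0.
Proof. by apply/eqP; rewrite dot_eq0. Qed.

Lemma dot_gt0 n (u : 'rV[R]_n) : (0 < '[u]) = (u != 0).
Proof. by rewrite lt_def dot_ge0 andbT dot_eq0. Qed.

(** The vector |v|^2 u - <u,v> v has squared norm |v|^2 (|u|^2 |v|^2 - <u,v>^2), which is
    nonnegative. *)
Lemma cauchy_schwarz n (u v : 'rV[R]_n) : '[u, v] ^+ 2 <= '[u] * '[v].
Proof.
have [->|v0] := eqVneq v 0.
  by rewrite -(scale0r 0) !dotZr !mul0r expr0n mulr0.
have := dot_ge0 _ ('[v] *: u - '[u, v] *: v).
rewrite -scaleNr !(dotDl, dotDr, dotZl, dotZr) (dotC _ v u).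
move: v0; rewrite -dot_gt0 => v0 H.
rewrite -subr_ge0 -(pmulr_rge0 _ v0).
by apply: le_trans H _; rewrite le_eqVlt; apply/orP; left; apply/eqP; ring.
Qed.

(** * Spectral theorem for real symmetric matrices *)

(** Over the complex extension there is an eigenvector a + ib with eigenvalue al + i be. Symmetry
    gives <aS, b> = <a, bS>, that is be (|a|^2 + |b|^2) = 0, so be = 0 and whichever of [a], [b] is
    nonzero is a real eigenvector. *)
Lemma symmetric_eigenvector n (S : 'M[R]_n) : (0 < n)%N -> S^T = S ->
  exists a, exists2 v : 'rV_n, v *m S = a *: v & v != 0.
Proof.
move=> n0 symS.
have [l /eigenvalueP [z zS z0]] := eigenvalue_closed (map_mx (real_complex R) S) n0.
pose a := \row_i complex.Re (z 0 i); pose b := \row_i complex.Im (z 0 i).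
case: l zS => al be zS.
have aS : a *m S = al *: a - be *: b.
  apply/rowP => j; rewrite !mxE; move/rowP/(_ j)/(congr1 (@complex.Re R)): zS.
  rewrite !mxE raddf_sum => E.
  transitivity (complex.Re ((al +i* be)%C * z 0 j)); last by case: (z 0 j).
  by rewrite -E; apply: eq_bigr => i _; rewrite !mxE; case: (z 0 i) => x y /=; ring.
have bS : b *m S = be *: a + al *: b.
  apply/rowP => j; rewrite !mxE; move/rowP/(_ j)/(congr1 (@complex.Im R)): zS.
  rewrite !mxE raddf_sum => E.
  transitivity (complex.Im ((al +i* be)%C * z 0 j)).
    by rewrite -E; apply: eq_bigr => i _; rewrite !mxE; case: (z 0 i) => x y /=; ring.
  by case: (z 0 j) => x y /=; ring.
have ab0 : (a != 0) || (b != 0).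
  rewrite -negb_and; apply: contra z0 => /andP [/eqP a0 /eqP b0].
  apply/eqP/rowP => i; move/rowP/(_ i): a0; move/rowP/(_ i): b0; rewrite !mxE.
  by case: (z 0 i) => x y /= -> ->.
have be0 : be = 0.
  have := dot_mulmx _ _ a S b; rewrite symS aS bS -scaleNr.
  rewrite !(dotDl, dotDr, dotZl, dotZr) => E.
  have {E} : be * ('[a] + '[b]) = 0 by lra.
  move/eqP; rewrite mulf_eq0 => /orP [/eqP //|].
  rewrite paddr_eq0 ?dot_ge0 // !dot_eq0 => /andP [/eqP a0 /eqP b0].
  by rewrite a0 b0 eqxx in ab0.
exists al; case/orP: ab0 => [a0|b0]; [exists a | exists b] => //.
  by rewrite aS be0 scale0r subr0.
by rewrite bS be0 scale0r add0r.
Qed.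

(* The witness is the Householder reflection along [v - e]. *)
Lemma reflection_exists n (e v : 'rV[R]_n) : '[e] = 1 -> '[v] = 1 ->
  exists2 H : 'M[R]_n, H^T = H & H *m H = 1%:M /\ e *m H = v.
Proof.
move=> e1 v1; have [<-|ev] := eqVneq e v.
  by exists 1%:M; rewrite ?trmx1 // !mulmx1.
have [w wE] : exists w, w = v - e by exists (v - e).
have w0 : '[w] != 0 by rewrite wE dot_eq0 subr_eq0 eq_sym.
exists (1%:M - (2 / '[w]) *: (w^T *m w)).
  by rewrite linearB linearZ /= trmx1 trmx_mul trmxK.
split.
  rewrite mulmxBl mul1mx mulmxBr mulmx1 -scalemxAl -scalemxAr scalerA.
  rewrite -mulmxA (mulmxA w) mulmx_trE mul_scalar_mx -scalemxAr scalerA.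
  rewrite -mulrA mulfVK // -addrA.
  by rewrite [in X in _ - X]mulr_natr [in X in _ - X]mulr2n scalerDl opprB addrK addNr addr0.
rewrite mulmxBr mulmx1 -scalemxAr mulmxA mulmx_trE mul_scalar_mx scalerA.
(* As [e] and [v] are unit vectors, |v - e|^2 = -2 <e, v - e>, so the reflection moves [e] by
   exactly [w]. *)
have -> : 2 / '[w] * '[e, w] = -1.
  have ww : '[w] = -2 * '[e, w].
    rewrite wE -scaleN1r !(dotDl, dotDr, dotZl, dotZr) e1 v1 (dotC _ v e); ring.
  apply: (mulIf w0); rewrite mulrAC mulfVK // ww; ring.
by rewrite scaleN1r opprK wE addrC subrK.
Qed.

(** Deflation: conjugating by a reflection that sends the first basis vector to a unit eigenvector
    splits off a 1 x 1 block, and induction diagonalizes the other block. The rows of [P] are the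
    eigenvectors. *)
Lemma symmetric_spectral n (S : 'M[R]_n) : S^T = S ->
  exists P : 'M[R]_n, exists d : 'rV[R]_n,
    P *m P^T = 1%:M /\ S = P^T *m diag_mx d *m P.
Proof.
elim: n S => [|n IHn] S.
  by exists 1%:M, 0; split; apply/matrixP => -[].
rewrite -[n.+1]/(1 + n)%N in S *; move=> symS.
have [a [v vS v0]] := symmetric_eigenvector _ S (ltn0Sn n) symS.
pose v1 := (Num.sqrt '[v])^-1 *: v.
have v1S : v1 *m S = a *: v1 by rewrite -scalemxAl vS scalerA mulrC -scalerA.
have v11 : '[v1] = 1.
  rewrite dotZl dotZr mulrA -invfM -expr2 sqr_sqrtr ?dot_ge0 // mulVf //.
  by rewrite dot_eq0.
have e1 : '[delta_mx 0 0 : 'rV[R]_(1 + n)] = 1.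
  by rewrite dotE (bigD1 0) //= !mxE mulr1 big1 ?addr0 // => i /negPf i0;
     rewrite !mxE i0 mulr0.
have [H symH [HH eH]] := reflection_exists _ (delta_mx 0 0 : 'rV[R]_(1 + n)) v1 e1 v11.
have [T defT] : exists T : 'M[R]_(1 + n), T = H *m S *m H.
  by exists (H *m S *m H).
have symT : T^T = T by rewrite defT !trmx_mul symH symS mulmxA.
(* [H] sends the basis vector to [v1], [S] scales it by [a], and [H], an involution, sends it back.
   By symmetry the first column of [T] has the same form. *)
have rowT : row 0 T = a *: delta_mx 0 0.
  rewrite rowE defT !mulmxA eH v1S -scalemxAl -eH -mulmxA HH mulmx1 //.
have T0 j : T 0 j = a * (j == 0)%:R.
  by move/rowP/(_ j): rowT; rewrite !mxE.
have TE : T = block_mx a%:M 0 0 (drsubmx T).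
  rewrite -{1}[T]submxK; congr block_mx.
  - by apply/matrixP => i j; rewrite !ord1 !mxE !lshift0 T0 eqxx mulr1.
  - apply/matrixP => i j; rewrite !ord1 !mxE lshift0 T0.
    by rewrite -val_eqE /= mulr0.
  - apply/matrixP => i j; rewrite !ord1 -symT !mxE lshift0 T0.
    by rewrite -val_eqE /= mulr0.
have [|P [d [PP TP]]] := IHn (drsubmx T).
  by rewrite -[in LHS]symT; apply/matrixP => i j; rewrite !mxE.
exists (block_mx 1%:M 0 0 P *m H), (row_mx a%:M d); split.
  rewrite trmx_mul symH mulmxA -(mulmxA _ H H) HH mulmx1.
  rewrite tr_block_mx !trmx0 trmx1 mulmx_block !mulmx1 !mul0mx !mulmx0 PP.
  by rewrite !addr0 !add0r -scalar_mx_block.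
have -> : S = H *m T *m H.
  by rewrite defT !mulmxA HH mul1mx -mulmxA HH mulmx1.
rewrite trmx_mul symH -!mulmxA; congr (H *m _); rewrite !mulmxA; congr (_ *m H).
rewrite TE tr_block_mx !trmx0 trmx1 diag_mx_row !mulmx_block.
rewrite !mulmx1 !mul1mx !mul0mx !mulmx0 !addr0 !add0r ?mul0mx ?mulmx0.
have -> : diag_mx a%:M = a%:M :> 'M[R]_1.
  by apply/matrixP => i j; rewrite !mxE !ord1.
by rewrite TP.
Qed.

End DotProduct.

(** * Singular values counted through the eigenvalues of X^T X *)

Section SingularValueCharacterization.
Context {R : realType}.
Local Notation "''[' u , v ]" := (dot _ u v).
Local Notation "''[' u ]" := (dot _ u u).

Lemma char_poly_orthogonal n (P : 'M[R]_n) (d : 'rV_n) : P *m P^T = 1%:M ->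
  char_poly (P^T *m diag_mx d *m P) = \prod_i ('X - (d 0 i)%:P).
Proof.
move=> PP; pose Q := map_mx polyC P; pose Q' := map_mx polyC P^T.
have QQ' : Q' *m Q = 1%:M by rewrite -map_mxM (mulmx1C PP) map_mx1.
transitivity (\det (Q' *m char_poly_mx (diag_mx d) *m Q)).
  rewrite /char_poly /char_poly_mx mulmxBr mulmxBl.
  by rewrite scalar_mxC -(mulmxA _ Q') QQ' mulmx1 !map_mxM.
rewrite !det_mulmx mulrC mulrA -det_mulmx (mulmx1C QQ') det1 mul1r.
transitivity (\prod_(i < n) ('X - (diag_mx d i i)%:P)).
  by apply: char_poly_trig; apply: diag_mx_is_trig.
by apply: eq_bigr => i _; rewrite mxE eqxx.
Qed.

Lemma count_flatten_nseq (T : eqType) (m : T -> nat) (s : seq T) (x : T) :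
  uniq s ->
  count_mem x (flatten [seq nseq (m y) y | y <- s])
  = (if x \in s then m x else 0)%N.
Proof.
elim: s => //= y s IHs /andP [ys us].
rewrite count_cat count_nseq IHs // in_cons eq_sym /=.
have [->|_] := eqVneq x y; last by rewrite mul0n.
by rewrite (negPf ys) mul1n addn0.
Qed.

(** Both lists contain each x as often as its multiplicity as a root. Since the characteristic
    polynomial splits over R, the real roots account for all of [s]. *)
Lemma perm_real_eigenvalues n (S : 'M[R]_n) (s : seq R) :
  char_poly S = \prod_(x <- s) ('X - x%:P) -> perm_eq (real_eigenvalues S) s.
Proof.
move=> Sp; have p0 : char_poly S != 0 by rewrite monic_neq0 ?char_poly_monic.
apply/allP => x _ /=; apply/eqP.
rewrite count_flatten_nseq; last by rewrite uniq_roots.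
have -> : (x \in rootsR (char_poly S)) = root (char_poly S) x.
  by rewrite -(roots_on_rootsR p0) in_itv.
rewrite Sp root_prod_XsubC mu_prod_XsubC; case: ifP => // /negbT.
by rewrite -has_pred1 has_count lt0n negbK => /eqP.
Qed.

(** In a non-increasing list the entries above [t] form an initial segment. The sign of [t] matters
    past the end, where the default 0 must not exceed [t]. *)
Lemma nth_sort_gt (s : seq R) t i : 0 <= t ->
  (t < nth 0 (sort >=%R s) i) = (i < count (> t) s)%N.
Proof.
move=> t0; rewrite -(permP (permEl (perm_sort >=%R s)) (> t)).
have : sorted >=%R (sort >=%R s) by apply: sort_sorted => x y; apply: le_total.
elim: (sort _ s) i => [|x r IHr] i /=; first by rewrite nth_nil ltNge t0.
move=> xr; have {}IHr j := IHr j (path_sorted xr).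
have r_le_x : all (>=%R x) r.
  by apply: order_path_min xr => a b c ba cb; apply: le_trans cb ba.
have r0 : (x <= t) -> count (> t) r = 0%N.
  move=> xt; apply/eqP; rewrite -leqn0 leqNgt -has_count -all_predC.
  by apply: sub_all r_le_x => y /= yx; rewrite -leNgt (le_trans yx).
have [tx|xt] := ltP t x; case: i => [|i] /=; rewrite ?tx ?IHr //.
all: by rewrite r0 // addn0 ltn0 ?ltNge ?xt.
Qed.
Lemma ltr_sqrtr (t x : R) : 0 <= t -> (t < Num.sqrt x) = (t ^+ 2 < x).
Proof.
move=> t0; have [x0|x0] := ltP 0 x.
  by rewrite -[t in LHS]ger0_norm // -sqrtr_sqr ltr_sqrt.
by rewrite ler0_sqrtr // ltNge t0 ltNge (le_trans x0) // sqr_ge0.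
Qed.

(** Sorting turns the order statistic into a count of eigenvalues above t^2. The first conjunct
    reflects the truncation of the list, beyond which [nth] returns 0. *)
Lemma lt_singular_value i p q (X : 'M[R]_(p, q)) (P : 'M_q) (d : 'rV_q) t :
    P *m P^T = 1%:M -> X^T *m X = P^T *m diag_mx d *m P -> 0 <= t ->
  (t < singular_value i X)
  = (i.-1 < minn p q)%N && (i.-1 < #|[pred j | (t ^+ 2 < d 0 j)%R]|)%N.
Proof.
move=> PP XX t0; rewrite /singular_value /singular_values.
have [ipq|ipq] := ltnP i.-1 (minn p q); last first.
  by rewrite nth_default ?ltNge ?t0 // (leq_trans _ ipq) // size_take_min geq_minl.
rewrite nth_take // nth_sort_gt //=; congr (_ < _)%N.
have /perm_map/permP -> : perm_eq (real_eigenvalues (X^T *m X))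
    [seq d 0 j | j <- enum 'I_q].
  by apply: perm_real_eigenvalues; rewrite XX char_poly_orthogonal // big_map big_enum.
rewrite -map_comp count_map cardE size_filter enumT.
by apply: eq_count => j /=; rewrite ltr_sqrtr.
Qed.

(** * Courant-Fischer principle by witness subspaces *)

Lemma dot_orthogonal n (P : 'M[R]_n) (u v : 'rV_n) :
  P *m P^T = 1%:M -> '[u *m P, v *m P] = '[u, v].
Proof. by move=> PP; rewrite dot_mulmx -mulmxA PP mulmx1. Qed.

Lemma mulmx_diagE n (y d : 'rV[R]_n) j : (y *m diag_mx d) 0 j = y 0 j * d 0 j.
Proof. by rewrite mul_mx_diag mxE. Qed.

(* The witness is the image under [X] of the span of the first [i] right
   singular vectors. *)
Lemma lt_singular_value_witness i p q (X : 'M[R]_(p, q)) t :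
    (0 < i)%N -> 0 <= t -> t < singular_value i X ->
  exists V : 'M[R]_(i, p), forall u : 'rV_i, u != 0 ->
    t ^+ 2 * '[u *m V] < '[u *m V *m X].
Proof.
move=> i0 t0.
have [|P [d [PP XX]]] := symmetric_spectral _ (X^T *m X).
  by rewrite trmx_mul trmxK.
rewrite (lt_singular_value i p q X P d) // prednK // => /andP [_ iJ].
set J := [pred j | _] in iJ.
pose f (k : 'I_i) := enum_val (widen_ord iJ k) : 'I_q.
have f_inj : injective f.
  by move=> k l /enum_val_inj /(congr1 val) /= /val_inj.
have fJ k : t ^+ 2 < d 0 (f k) by have := enum_valP (widen_ord iJ k).
exists (rowsub f 1%:M *m P *m X^T) => u u0.
(* [y] places the entries of [u] at [i] distinct indices of [J], so it is supported where [d]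
   exceeds t^2. *)
pose y := u *m rowsub f 1%:M.
have yE j : y 0 j = \sum_k u 0 k * (f k == j)%:R.
  by rewrite mxE; apply: eq_bigr => k _; rewrite !mxE.
have yf k : y 0 (f k) = u 0 k.
  rewrite yE (bigD1 k) //= eqxx mulr1 big1 ?addr0 // => l lk.
  by rewrite (inj_eq f_inj) (negPf lk) mulr0.
have yJ j : y 0 j != 0 -> t ^+ 2 < d 0 j.
  move=> yj; suff /existsP [k /eqP <-] : [exists k, f k == j] by [].
  apply: contraR yj => /existsPn fj; rewrite yE big1 // => k _.
  by rewrite (negPf (fj k)) mulr0.
have -> : u *m (rowsub f 1%:M *m P *m X^T) = y *m P *m X^T.
  by rewrite /y !mulmxA.
have yPXX : y *m P *m X^T *m X = y *m diag_mx d *m P.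
  by rewrite -(mulmxA _ X^T) XX !mulmxA -(mulmxA y P) PP mulmx1.
(* In eigenbasis coordinates the claim reads t^2 \sum_j d_j y_j^2 < \sum_j d_j^2 y_j^2. It holds
   term by term, strictly where y_j is nonzero. *)
rewrite dot_mulmx trmxK yPXX !(dot_orthogonal _ P _ _ PP) !dotE mulr_sumr.
have [k uk] : exists k, u 0 k != 0.
  by apply/existsP; apply: contraR u0 => /existsPn u0;
     apply/eqP/rowP => k; rewrite mxE; apply/eqP/negPn.
have term j : y 0 j != 0 -> t ^+ 2 * (y 0 j * (y *m diag_mx d) 0 j)
    < (y *m diag_mx d) 0 j * (y *m diag_mx d) 0 j.
  move=> yj; rewrite mulmx_diagE; have tj := yJ j yj.
  have y2 : 0 < y 0 j ^+ 2 by rewrite exprn_even_gt0.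
  have dj : 0 < d 0 j by apply: le_lt_trans tj; rewrite sqr_ge0.
  rewrite -subr_gt0.
  have -> : y 0 j * d 0 j * (y 0 j * d 0 j) - t ^+ 2 * (y 0 j * (y 0 j * d 0 j))
    = (d 0 j - t ^+ 2) * (y 0 j ^+ 2 * d 0 j) by ring.
  by apply: mulr_gt0; [rewrite subr_gt0 | apply: mulr_gt0].
rewrite (bigD1 (f k)) // [ltRHS](bigD1 (f k)) //=.
apply: ltr_leD; first by apply: term; rewrite yf.
apply: ler_sum => j _; have [yj|/term /ltW //] := eqVneq (y 0 j) 0.
by rewrite !mulmx_diagE yj !(mul0r, mulr0).
Qed.

(** A nonzero [u] killed by [V *m X] would put 0 strictly above a nonnegative number. Hence a
    witness forces [i] to be at most the rank of [X]. *)
Lemma witness_row_free i p q (X : 'M[R]_(p, q)) (V : 'M_(i, p)) t :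
    (forall u : 'rV_i, u != 0 -> t ^+ 2 * '[u *m V] < '[u *m V *m X]) ->
  row_free (V *m X).
Proof.
move=> VX; apply: inj_row_free => u; rewrite mulmxA => uVX.
apply/eqP; apply: contraT => /VX; rewrite uVX.
by rewrite dot00 ltNge mulr_ge0 ?sqr_ge0 ?dot_ge0.
Qed.

(** If fewer than [i] eigenvalues exceeded t^2, a dimension count would give a nonzero [u] whose
    image u V X is orthogonal to all their eigenvectors. On such an image X^T stretches by at most
    [t], which contradicts the witness inequality. *)
Lemma witness_lt_singular_value i p q (X : 'M[R]_(p, q)) (V : 'M_(i, p)) t :
    (0 < i)%N -> 0 <= t ->
    (forall u : 'rV_i, u != 0 -> t ^+ 2 * '[u *m V] < '[u *m V *m X]) ->
  t < singular_value i X.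
Proof.
move=> i0 t0 VX.
have [|P [d [PP XX]]] := symmetric_spectral _ (X^T *m X).
  by rewrite trmx_mul trmxK.
rewrite (lt_singular_value i p q X P d) // prednK //; apply/andP; split.
  rewrite -(eqP (witness_row_free _ _ _ _ _ _ VX)) leq_min.
  by rewrite rank_leq_col (leq_trans (mxrankM_maxr _ _)) // rank_leq_row.
set J := [pred j | _]; rewrite leqNgt; apply/negP => Ji.
(* The columns of [B] are the coordinates of [V *m X] along the eigenvectors indexed by [J]. There
   are fewer of them than rows, so the left kernel is nonzero. *)
pose B := colsub (enum_val : 'I_#|J| -> 'I_q) (V *m X *m P^T).
have [u u0 uB] : exists2 u : 'rV_i, u != 0 & u *m B = 0.
  have : kermx B != 0.
    by rewrite -mxrank_eq0 mxrank_ker subn_eq0 -ltnNge (leq_ltn_trans (rank_leq_col _)).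
  by move=> /rowV0Pn [u /sub_kermxP uB u0]; exists u.
have {VX} := VX u u0; set w := u *m V => wX.
pose y := w *m X *m P^T.
have yP : y *m P = w *m X by rewrite /y -mulmxA (mulmx1C PP) mulmx1.
have yJ j : t ^+ 2 < d 0 j -> y 0 j = 0.
  move=> jJ; have jJ' : j \in J by [].
  move/rowP/(_ (enum_rank_in jJ' j)): uB.
  by rewrite /B mulmx_colsub [LHS]mxE enum_rankK_in // [RHS]mxE /y /w !mulmxA.
have wXX : '[w *m X *m X^T] <= t ^+ 2 * '[w *m X].
  rewrite dot_mulmx trmxK -(mulmxA _ X^T) XX -yP !mulmxA -(mulmxA y P) PP mulmx1.
  rewrite !(dot_orthogonal _ P _ _ PP) !dotE mulr_sumr ler_sum // => j _.
  rewrite mulmx_diagE; have [jJ|jJ] := ltP (t ^+ 2) (d 0 j).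
    by rewrite yJ // !mul0r mulr0.
  by rewrite mulrA [leRHS]mulrC ler_wpM2l -?expr2 ?sqr_ge0.
(* With |w X|^2 = <w, w X X^T> this gives |w X|^4 <= |w|^2 t^2 |w X|^2 < |w X|^4. *)
have := cauchy_schwarz _ w (w *m X *m X^T).
rewrite dotC dot_mulmx trmxK => CS.
have wX0 : 0 < '[w *m X].
  by apply: le_lt_trans wX; rewrite mulr_ge0 ?sqr_ge0 ?dot_ge0.
have : '[w *m X] ^+ 2 < '[w *m X] ^+ 2.
  apply: le_lt_trans CS _; apply: (@le_lt_trans _ _ ('[w] * (t ^+ 2 * '[w *m X]))).
    by rewrite ler_wpM2l ?dot_ge0.
  by rewrite mulrA (mulrC '[w]) expr2 ltr_pM2r.
by rewrite ltxx.
Qed.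

(** * The spectral norm as a bound on quadratic forms *)

Lemma l2normE n (v : 'rV[R]_n) : l2norm v^T = Num.sqrt '[v].
Proof.
by rewrite /l2norm dotE; congr Num.sqrt; apply: eq_bigr => i _; rewrite !mxE.
Qed.

(** Cauchy-Schwarz on each row gives this Frobenius bound. It serves to show that the set under the
    [sup] of [spectral_norm] is bounded above. *)
Lemma dot_mulmx_tr_bounded p q (X : 'M[R]_(p, q)) (v : 'rV_q) :
  '[v *m X^T] <= (\sum_i '[row i X]) * '[v].
Proof.
rewrite [leLHS]dotE mulr_suml ler_sum // => i _.
have -> : (v *m X^T) 0 i = '[v, row i X].
  by rewrite dotE mxE; apply: eq_bigr => j _; rewrite !mxE.
by rewrite mulrC -expr2; apply: le_trans (cauchy_schwarz _ _ _) _; rewrite mulrC.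
Qed.

Lemma sqrt_dot_le_spectral_norm p q (X : 'M[R]_(p, q)) (v : 'rV_q) :
  '[v] <= 1 -> Num.sqrt '[v *m X^T] <= spectral_norm X.
Proof.
move=> v1; apply: ub_le_sup; last first.
  exists v^T; first by rewrite /= l2normE -sqrtr1 ler_wsqrtr.
  by rewrite -l2normE trmx_mul trmxK.
exists (Num.sqrt (\sum_i '[row i X])) => _ [w /= w1 <-].
rewrite -[X *m w]trmxK l2normE trmx_mul ler_wsqrtr //.
apply: le_trans (dot_mulmx_tr_bounded _ _ _ _) _.
have w2 : '[w^T] <= 1.
  by rewrite -(@ler_sqrt _ _ 1) ?ler01 // sqrtr1 -l2normE trmxK.
by rewrite ler_piMr // sumr_ge0 // => i _; apply: dot_ge0.
Qed.

Lemma spectral_norm_ge0 p q (X : 'M[R]_(p, q)) : 0 <= spectral_norm X.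
Proof.
apply: le_trans (sqrt_dot_le_spectral_norm _ _ X 0 _); first exact: sqrtr_ge0.
by rewrite dot00 ler01.
Qed.

Lemma dot_mulmx_tr_le p q (X : 'M[R]_(p, q)) (v : 'rV_q) :
  '[v *m X^T] <= spectral_norm X ^+ 2 * '[v].
Proof.
have [->|v0] := eqVneq v 0.
  by rewrite mul0mx !dot00 mulr0.
have v2 : 0 < '[v] by rewrite dot_gt0.
have := sqrt_dot_le_spectral_norm _ _ X ((Num.sqrt '[v])^-1 *: v).
have scale_dot w : '[(Num.sqrt '[v])^-1 *: w] = '[w] / '[v] :> R.
  by rewrite dotZl dotZr mulrA -invfM -expr2 sqr_sqrtr ?dot_ge0 // mulrC.
rewrite scale_dot divff ?gt_eqF // lexx => /(_ isT).
rewrite -scalemxAl dotZl dotZr mulrA -invfM -expr2 sqr_sqrtr ?dot_ge0 // => H.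
rewrite mulrC -ler_pdivrMl // -[leLHS]sqr_sqrtr; last first.
  by rewrite mulr_ge0 ?invr_ge0 ?dot_ge0.
by rewrite ler_pXn2r // nnegrE ?sqrtr_ge0 ?spectral_norm_ge0.
Qed.

(** The norm is defined by the action on columns. It also bounds the action on rows, since |u X|^4 =
    <u, u X X^T>^2 <= |u|^2 |u X X^T|^2 and the last factor is covered by the column bound. *)
Lemma dot_mulmx_le p q (X : 'M[R]_(p, q)) (u : 'rV_p) :
  '[u *m X] <= spectral_norm X ^+ 2 * '[u].
Proof.
have [->|uX0] := eqVneq (u *m X) 0.
  by rewrite dot00 mulr_ge0 ?sqr_ge0 ?dot_ge0.
have uX2 : 0 < '[u *m X] by rewrite dot_gt0.
rewrite -(ler_pM2r uX2) -expr2 {1}dot_mulmx.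
apply: le_trans (cauchy_schwarz _ _ _) _.
rewrite mulrAC mulrC ler_wpM2r ?dot_ge0 //; exact: dot_mulmx_tr_le.
Qed.

(** The difference is 2 <uA, uE> + |uE|^2; Cauchy-Schwarz on the cross term produces the mixed
    product of norms. *)
Lemma dot_mulmxD_dist p q (A E : 'M[R]_(p, q)) (u : 'rV_p) :
  `|'[u *m (A + E)] - '[u *m A]|
  <= (2 * spectral_norm A * spectral_norm E + spectral_norm E ^+ 2) * '[u].
Proof.
have uA := dot_mulmx_le _ _ A u; have uE := dot_mulmx_le _ _ E u.
have uAE : `|'[u *m A, u *m E]| <= spectral_norm A * spectral_norm E * '[u].
  have ge0 : 0 <= spectral_norm A * spectral_norm E * '[u].
    by rewrite !mulr_ge0 ?spectral_norm_ge0 ?dot_ge0.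
  rewrite -(@ler_pXn2r _ 2) ?nnegrE // real_normK ?num_real //.
  apply: le_trans (cauchy_schwarz _ _ _) _.
  apply: le_trans (ler_pM (dot_ge0 _ _) (dot_ge0 _ _) uA uE) _.
  by rewrite le_eqVlt; apply/orP; left; apply/eqP; ring.
have -> : '[u *m (A + E)] - '[u *m A] = 2 * '[u *m A, u *m E] + '[u *m E].
  rewrite mulmxDr !(dotDl, dotDr) (dotC _ (u *m E) (u *m A)); ring.
apply: le_trans (ler_normD _ _) _.
rewrite normrM (ger0_norm (dot_ge0 _ _)) ger0_norm // [leRHS]mulrDl lerD //.
by rewrite -!mulrA ler_wpM2l // mulrA.
Qed.

Lemma dot_mxrow p k (q : 'I_k -> nat) (B : forall j, 'M[R]_(p, q j))
    (u : 'rV_p) : '[u *m \mxrow_j B j] = \sum_j '[u *m B j].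
Proof.
rewrite mul_mxrow /dot tr_mxrow mul_mxrow_mxcol summxE.
by apply: eq_bigr => j _.
Qed.

(** * Singular values against rank, and comparison of two matrices *)

Lemma singular_value_ge0 i p q (X : 'M[R]_(p, q)) : 0 <= singular_value i X.
Proof.
rewrite /singular_value; set s := singular_values X.
have [/(nth_default 0) -> //|/(mem_nth 0)] := leqP (size s) i.-1.
by move/mem_take; rewrite mem_sort => /mapP [x _ ->]; apply: sqrtr_ge0.
Qed.

(** At t = 0 a witness only needs u V X to be nonzero. By the rank factorization of [X], the first
    [i] rows of the inverse of [col_ebase X] are mapped by [X] to the first [i] rows of the
    invertible [row_ebase X]. *)
Lemma singular_value_gt0 i p q (X : 'M[R]_(p, q)) :
  (0 < i <= \rank X)%N -> 0 < singular_value i X.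
Proof.
move=> /andP [i0 iX].
apply: (witness_lt_singular_value i p q X (pid_mx i *m invmx (col_ebase X))) => // u.
have VX : pid_mx i *m invmx (col_ebase X) *m X
    = (pid_mx i : 'M_(i, q)) *m row_ebase X.
  rewrite -{2}[X]mulmx_ebase !mulmxA mulmxKV ?col_ebase_unit // mul_pid_mx.
  by rewrite (minn_idPl iX) (minn_idPr (leq_trans iX (rank_leq_row X))).
rewrite expr0n mul0r dot_gt0 -mulmxA VX; apply: contra => /eqP uX.
have iq : (i <= q)%N by rewrite (leq_trans iX) ?rank_leq_col.
have := congr1 (mulmxr (invmx (row_ebase X) *m (pid_mx i : 'M_(q, i)))) uX.
rewrite /= mul0mx !mulmxA mulmxK ?row_ebase_unit // -mulmxA mul_pid_mx.
by rewrite minnn (minn_idPr iq) pid_mx_1 mulmx1 => ->.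
Qed.

(** A positive value would yield a witness [V] with [V *m X] of rank [i], more than the rank of
    [X]. *)
Lemma singular_value_gt_rank i p q (X : 'M[R]_(p, q)) :
  (\rank X < i)%N -> singular_value i X = 0.
Proof.
move=> Xi; apply/eqP; rewrite eq_le singular_value_ge0 andbT leNgt.
apply/negP => /(lt_singular_value_witness _ _ _ _ _ (leq_ltn_trans (leq0n _) Xi) (lexx _)).
case=> V /witness_row_free /eqP VX.
by move: Xi; rewrite -VX ltnNge mxrankM_maxr.
Qed.

(** With y = sigma_i(Y), a witness for [X] at level sqrt(a y^2 + s) is a witness for [Y] at level y:
    the terms in [s] cancel and [a] divides out. This would give y < y. *)
Lemma singular_value_sqr_le i p q q' (X : 'M[R]_(p, q)) (Y : 'M_(p, q')) a s :
    (0 < i)%N -> 0 < a -> 0 <= s ->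
    (forall u : 'rV_p, '[u *m X] <= a * '[u *m Y] + s * '[u]) ->
  singular_value i X ^+ 2 <= a * singular_value i Y ^+ 2 + s.
Proof.
move=> i0 a0 s0 XY; rewrite leNgt; apply/negP => H.
set y := singular_value i Y in H.
have c0 : 0 <= a * y ^+ 2 + s.
  by apply: addr_ge0 => //; rewrite pmulr_rge0 ?sqr_ge0.
have : Num.sqrt (a * y ^+ 2 + s) < singular_value i X.
  by rewrite -[ltRHS]ger0_norm ?singular_value_ge0 // -sqrtr_sqr ltr_sqrt //
     (le_lt_trans c0).
case/(lt_singular_value_witness _ _ _ _ _ i0 (sqrtr_ge0 _)) => V.
rewrite sqr_sqrtr // => VX.
suff : y < y by rewrite ltxx.
apply: (witness_lt_singular_value _ _ _ _ V _ i0) => //.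
  exact: singular_value_ge0.
move=> u /VX /lt_le_trans /(_ (XY _)).
by rewrite mulrDl ltrD2r -mulrA ltr_pM2l.
Qed.

(** * The concatenated matrix: perturbation of its quadratic form and the two bounds *)

Lemma concat_perturbation_bound m n k (A : 'M[R]_(m, n))
    (E : nat -> 'M[R]_(m, n)) (u : 'rV_m) : (0 < k)%N ->
  `|'[u *m \mxrow_(j < k) (if j == 0%N :> nat then A else A + E j.+1)]
    - k%:R * '[u *m A]|
  <= (\sum_(2 <= j < k.+1) (2 * spectral_norm A * spectral_norm (E j)
                            + spectral_norm (E j) ^+ 2)) * '[u].
Proof.
move=> k0; rewrite dot_mxrow.
have -> : k%:R * '[u *m A] = \sum_(j < k) '[u *m A].
  by rewrite sumr_const card_ord mulr_natl.
rewrite -sumrB; apply: le_trans (ler_norm_sum _ _ _) _.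
(* Block 0 is [A] itself and contributes nothing; shifting the remaining indices by one matches the
   sum that starts at 2. *)
rewrite -(big_mkord xpredT (fun j => `|'[u *m (if j == 0%N then A else A + E j.+1)]
                                      - '[u *m A]|)) big_ltn //= subrr normr0 add0r.
rewrite [in leRHS]big_add1 mulr_suml; apply: ler_sum_nat => -[//|j] _ /=.
exact: dot_mulmxD_dist.
Qed.

(** Since y <= x + y, |x - y| y <= |x - y| (x + y) = |x^2 - y^2| <= s. *)
Lemma dist_le_of_sqr_dist (x y s : R) : 0 <= x -> 0 < y ->
  x ^+ 2 <= y ^+ 2 + s -> y ^+ 2 <= x ^+ 2 + s -> `|x - y| <= y^-1 * s.
Proof.
move=> x0 y0 xy yx; rewrite ler_pdivlMl //.
have xDy : 0 <= x + y by rewrite addr_ge0 // ltW.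
apply: (@le_trans _ _ (`|x - y| * (x + y))).
  by rewrite mulrC ler_wpM2l // lerDr.
by rewrite -{1}[x + y]ger0_norm // -normrM -subr_sqr ler_norml; lra.
Qed.

End SingularValueCharacterization.

Theorem corollary1 (R : realType) (m n k : nat)
    (hm : (1 <= m)%N) (hn : (1 <= n)%N) (hk : (1 <= k)%N)
    (A : 'M[R]_(m, n)) (E : nat -> 'M[R]_(m, n)) :
  (* block j < k is the (j + 1)-st block; only E 2, ..., E k are used *)
  let M := \mxrow_(j < k) (if j == 0%N :> nat then A else A + E j.+1) in
  let s := \sum_(2 <= j < k.+1)
             (2 * spectral_norm A * spectral_norm (E j)
              + spectral_norm (E j) ^+ 2) in
  (forall i : nat, (1 <= i <= \rank A)%N ->
     `|singular_value i M - Num.sqrt k%:R * singular_value i A|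
       <= (Num.sqrt k%:R * singular_value i A)^-1 * s)
  /\
  (forall i : nat, (\rank A + 1 <= i <= minn m (k * n))%N ->
     singular_value i M <= Num.sqrt s).
Proof.
move=> M s.
have k0 : (0 : R) < k%:R by rewrite ltr0n.
have s0 : 0 <= s.
  by apply: sumr_ge0 => j _; rewrite addr_ge0 ?mulr_ge0 ?sqr_ge0 ?spectral_norm_ge0.
have MA u := concat_perturbation_bound m n k A E u hk.
have le_MA i : (0 < i)%N ->
    singular_value i M ^+ 2 <= k%:R * singular_value i A ^+ 2 + s.
  move=> i0; apply: singular_value_sqr_le => // u.
  by have := MA u; rewrite ler_norml -/M -/s; lra.
have le_AM i : (0 < i)%N ->
    k%:R * singular_value i A ^+ 2 <= singular_value i M ^+ 2 + s.
  (* Dividing by [k] isolates sigma_i(A)^2, so the comparison applies with coefficient 1/k and error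
     s/k. *)
  move=> i0; rewrite -ler_pdivlMl // mulrDr.
  apply: singular_value_sqr_le => //; first by rewrite invr_gt0.
    by rewrite mulr_ge0 ?invr_ge0 ?(ltW k0).
  move=> u; rewrite -!mulrA -mulrDr ler_pdivlMl //.
  by have := MA u; rewrite ler_norml -/M -/s; lra.
split=> i /andP [].
  move=> i0 iA; have sA : 0 < singular_value i A by rewrite singular_value_gt0 ?i0.
  apply: dist_le_of_sqr_dist.
  - exact: singular_value_ge0.
  - by rewrite mulr_gt0 ?sqrtr_gt0.
  - by rewrite exprMn sqr_sqrtr ?(ltW k0) //; apply: le_MA.
  - by rewrite exprMn sqr_sqrtr ?(ltW k0) //; apply: le_AM.
(* Here [i] may exceed min(m, n); [singular_value i A] is then the default 0, so the comparison with
   [A] still gives sigma_i(M)^2 <= s. *)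
rewrite addn1 => Ai _; have := le_MA i (leq_ltn_trans (leq0n _) Ai).
rewrite (singular_value_gt_rank _ _ _ _ Ai) expr0n mulr0 add0r => Ms.
by rewrite -[leLHS]ger0_norm ?singular_value_ge0 // -sqrtr_sqr ler_wsqrtr.
Qed.
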